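(* Let $n\ge1$. As polynomials in the indeterminates $x$ and $y$ with coefficients in $\mathbb{Q}[\mathfrak{B}_n]$, \[\rho_B(x)\rho_B(y)=\rho_B(xy),\qquad\text{where }\rho_B(x)=\sum_{\pi\in\mathfrak{B}_n}\Omega'_B(\pi;(x-1)/4)\,\pi.\]
   Context: $\mathfrak{B}_n$ is the hyperoctahedral group of signed permutations: bijections $\pi$ of $\{-n,\dots,-1,0,1,\dots,n\}$ with $\pi(-i)=-\pi(i)$, written as words $(\pi(1),\dots,\pi(n))$, with $\pi(0)=0$; multiplication in $\mathbb{Q}[\mathfrak{B}_n]$ is composition. For an integer $k\ge0$ let $Z_k$ be the totally ordered set $0<\bar1<1<\bar2<2<\dots<\bar k<k$, where $0$ and unbarred $j$ are ''plus-type'' and barred $\bar j$ are ''minus-type''. The type B enriched order polynomial $\Omega'_B(\pi;k)$ is the number of sequences $(a_1,\dots,a_n)\in Z_k^n$ such that, setting $a_0=0$, we have $a_0\le a_1\le\dots\le a_n$ and for every $s\in\{0,1,\dots,n-1\}$: if $\pi(s)<\pi(s+1)$ then $a_s<a_{s+1}$ or ($a_s=a_{s+1}$ is plus-type); if $\pi(s)>\pi(s+1)$ then $a_s<a_{s+1}$ or ($a_s=a_{s+1}$ is minus-type). As a function of $k$ this is the restriction of a unique polynomial with rational coefficients, denoted by the same symbol. *)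

(* Defs.v *)
From mathcomp Require Import all_boot all_order all_algebra all_fingroup.
Set Implicit Arguments. Unset Strict Implicit. Unset Printing Implicit Defensive.
Import GRing.Theory Num.Theory.
Local Open Scope ring_scope.

(* Signed permutations of [-n..n]: the value +(i+1) is encoded as (i, false)
   and -(i+1) as (i, true), for i : 'I_n.  A signed permutation is a
   permutation s of 'I_n * bool commuting with the sign flip. *)
Definition sflip n (x : 'I_n * bool) : 'I_n * bool := (x.1, ~~ x.2).

Definition is_signed n (s : {perm 'I_n * bool}) : bool :=
  [forall x, s (sflip x) == sflip (s x)].

Definition SB n := {s : {perm 'I_n * bool} | is_signed s}.

Definition sval_int n (x : 'I_n * bool) : int :=
  if x.2 then - (x.1.+1)%:Z else (x.1.+1)%:Z.

Definition sb_word n (p : SB n) : seq int :=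
  0 :: [seq sval_int (val p (i, false)) | i <- enum 'I_n].

(* Z_k = {0 < 1bar < 1 < 2bar < 2 < ... < kbar < k} is encoded by 'I_(2k+1):
   0 |-> 0, jbar |-> 2j-1, j |-> 2j.  Plus-type = even, minus-type = odd. *)
Definition omegaB_cond n k (p : SB n) (a : {ffun 'I_n -> 'I_(2 * k + 1)}) : bool :=
  let w := sb_word p in
  let av := 0%N :: [seq val (a i) | i <- enum 'I_n] in
  [forall s : 'I_n,
     (nth 0%N av s <= nth 0%N av s.+1)%N &&
     (if nth 0 w s < nth 0 w s.+1 then
        (nth 0%N av s < nth 0%N av s.+1)%N ||
        ((nth 0%N av s == nth 0%N av s.+1) && ~~ odd (nth 0%N av s))
      else if nth 0 w s.+1 < nth 0 w s then
        (nth 0%N av s < nth 0%N av s.+1)%N ||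
        ((nth 0%N av s == nth 0%N av s.+1) && odd (nth 0%N av s))
      else true)].

Definition omegaB n (p : SB n) (k : nat) : nat :=
  #|[set a : {ffun 'I_n -> 'I_(2 * k + 1)} | omegaB_cond p a]|.

(* Elements of Q[B_n][x,y] = R[B_n] with R = Q[x,y] represented as
   {poly {poly rat}} (x = inner variable, y = outer variable).
   Multiplication is convolution with the product pi*tau = pi o tau;
   in mathcomp, (t * s)%g x = s (t x), so pi o tau = (val tau * val pi)%g. *)
Definition ga_mul n (R : pzRingType) (a b : {ffun SB n -> R}) : {ffun SB n -> R} :=
  [ffun g => \sum_(p : SB n) \sum_(q : SB n | (val q * val p)%g == val g) a p * b q].

Definition polyXY := {poly {poly rat}}.
Definition varX : polyXY := ('X : {poly rat})%:P.
Definition varY : polyXY := 'X.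

Definition rhoB n (P : SB n -> {poly rat}) (z : polyXY) : {ffun SB n -> polyXY} :=
  [ffun p => (map_poly (fun c : rat => (c%:P)%:P : polyXY) (P p)).[(z - 1) * ((4%:R : rat)^-1)%:P%:P]].

(* Main.v *)
Require Import Defs.
From mathcomp Require Import all_boot all_order all_algebra all_fingroup.
From mathcomp Require Import zify.
Import Order.TTheory GRing.Theory Num.Theory.
Local Open Scope ring_scope.
Set Implicit Arguments. Unset Strict Implicit. Unset Printing Implicit Defensive.

(* A sequence counted by Omega'_B(p; k) unfolds to a function h from the signed
   letters to the 4k+1 values -k < ... < -1bar < 0 < 1bar < ... < k with
   h(-x) = -h(x), whose fibres are read in increasing order at plus-type values
   and in decreasing order at minus-type values; p is the signed permutation
   that sorts the letters by h.  The types alternate along the 4k+1 values.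
   Refining a function with 4l+1 values by one with 4k+1 values, reversed on the
   minus-type fibres of the coarse one, gives a function with
   (4l+1)(4k+1) alternating values, and sorting by it amounts to sorting first by
   the fine function and then by the coarse one.  Hence the identity holds at
   x = 4k+1, y = 4l+1 for all k and l, and so as an identity of polynomials. *)

(** * Isomorphisms between finite strict total orders *)

Definition strict_total (T : eqType) (r : rel T) : Prop :=
  [/\ irreflexive r, transitive r & forall x y, x != y -> r x y || r y x].

Section OrderIsomorphisms.

Variable T : finType.
Implicit Types (r : rel T) (p : {perm T}).

Definition rank r (x : T) : nat := #|[set y | r y x]|.

Lemma rank_lt r x : strict_total r -> (rank r x < #|T|)%N.
Proof.
move=> [irr _ _]; rewrite -cardsT; apply: proper_card; apply/properP.
split; first exact: subsetT.
by exists x; rewrite !inE ?irr.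
Qed.

Lemma rank_mono r x y : strict_total r -> r x y -> (rank r x < rank r y)%N.
Proof.
move=> [irr tr _] rxy; apply: proper_card; apply/properP; split.
  by apply/subsetP => z; rewrite !inE => rzx; apply: tr rxy.
by exists x; rewrite !inE ?irr.
Qed.

Lemma rank_inj r : strict_total r -> injective (rank r).
Proof.
move=> st x y Exy; apply/eqP/negPn/negP => nxy.
have [_ _ /(_ _ _ nxy)] := st.
by case/orP => /(rank_mono st); rewrite Exy ltnn.
Qed.

Definition order_iso r r' p := [forall x, forall y, r x y ==> r' (p x) (p y)].

Lemma order_isoP r r' p :
  reflect (forall x y, r x y -> r' (p x) (p y)) (order_iso r r' p).
Proof.
apply: (iffP forallP) => [h x y|h x]; last by apply/forallP => y; apply/implyP/h.
by move/forallP: (h x) => /(_ y)/implyP.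
Qed.

(** Preserving the order in one direction is enough: if [r x y] failed, totality would give [x = y]
    or [r y x], and both contradict [r' (p x) (p y)]. *)
Lemma order_isoE r r' p : strict_total r -> strict_total r' ->
  order_iso r r' p -> forall x y, r' (p x) (p y) = r x y.
Proof.
move=> [_ _ tot] [irr tr _] /order_isoP h x y.
apply/idP/idP => [r'xy|]; last exact: h.
have [Exy|/tot/orP[]//] := eqVneq x y; first by rewrite Exy irr in r'xy.
by move=> /h /(tr _ _ _ r'xy); rewrite irr.
Qed.

Lemma rank_iso r r' p x : strict_total r -> strict_total r' ->
  order_iso r r' p -> rank r' (p x) = rank r x.
Proof.
move=> st st' iso; rewrite {1}/rank -(card_preimset _ (@perm_inj _ p)).
by apply: eq_card => y; rewrite !inE (order_isoE st st' iso).
Qed.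

(** An isomorphism preserves ranks, and the rank determines the element. *)
Lemma order_iso_inj r r' p q : strict_total r -> strict_total r' ->
  order_iso r r' p -> order_iso r r' q -> p = q.
Proof.
move=> st st' hp hq; apply/permP => x; apply: (rank_inj st').
by rewrite !(rank_iso (r := r)).
Qed.

(** Ranks biject [T] with the integers below [#|T|], so each element can be sent to the one of equal
    rank for the other order. *)
Lemma order_iso_exists r r' : strict_total r -> strict_total r' ->
  exists p, order_iso r r' p.
Proof.
move=> st st'.
have rank_surj x : exists y, rank r' y == rank r x.
  pose f y := Ordinal (rank_lt y st').
  have f_inj : injective f by move=> y z /(congr1 val) /(rank_inj st').
  have [g _ gK] : bijective f by apply: inj_card_bij => //; rewrite card_ord.
  exists (g (Ordinal (rank_lt x st))).
  by have /(congr1 val) /= -> := gK (Ordinal (rank_lt x st)).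
pose f x := xchoose (rank_surj x).
have fE x : rank r' (f x) = rank r x by apply/eqP/(xchooseP (rank_surj x)).
have f_inj : injective f.
  by move=> x y Exy; apply: (rank_inj st); rewrite -!fE Exy.
exists (perm f_inj); apply/order_isoP => x y rxy; rewrite !permE.
have [irr _ tot] := st'.
have nxy : f x != f y.
  by apply/eqP => /f_inj Exy; have := rank_mono st rxy; rewrite Exy ltnn.
have /orP[//|/(rank_mono st')] := tot _ _ nxy.
by rewrite !fE ltnNge ltnW // rank_mono.
Qed.

End OrderIsomorphisms.

(** * Sorting the signed letters by an odd function *)

Section SignedSorting.

Variable n : nat.
Local Notation X := ('I_n * bool)%type.
Implicit Types (x y : X) (p : {perm X}).

Definition sless : rel X := fun x y => sval_int x < sval_int y.

(* Values are shifted to 0, ..., M-1 with M = 1 mod 4 in mind: plus-type is even,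
   minus-type is odd, and negation of a value is [rev_ord]. *)
Definition tie_less M (h : {ffun X -> 'I_M}) : rel X := fun x y =>
  (h x < h y)%N || (h x == h y :> nat) && (if odd (h x) then sless y x else sless x y).

Definition odd_fun M (h : {ffun X -> 'I_M}) : bool :=
  [forall x, h (sflip x) == rev_ord (h x)].

Lemma sflipK : involutive (@sflip n).
Proof. by case=> i b; rewrite /sflip /= negbK. Qed.

Lemma sval_int_inj : injective (@sval_int n).
Proof.
move=> [i b] [j c]; rewrite /sval_int /=; case: b c => [] [] E; try lia.
all: by congr (_, _); apply: val_inj => /=; lia.
Qed.

Lemma sval_int_flip x : sval_int (sflip x) = - sval_int x.
Proof. by rewrite /sval_int /=; case: (x.2) => //=; rewrite opprK. Qed.

Lemma sless_flip x y : sless (sflip x) (sflip y) = sless y x.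
Proof. by rewrite /sless !sval_int_flip ltrN2. Qed.

Lemma sless_total : strict_total sless.
Proof.
split=> [x|y x z|x y nxy]; rewrite /sless ?ltxx //; first exact: lt_trans.
rewrite -neq_lt; apply: contraNN nxy => /eqP /sval_int_inj ->//.
Qed.

Lemma tie_less_total M (h : {ffun X -> 'I_M}) : strict_total (tie_less h).
Proof.
have [irr tr tot] := sless_total; split=> [x|y x z|x y nxy].
- by rewrite /tie_less ltnn eqxx irr if_same.
- rewrite /tie_less => /orP[lxy|/andP[/eqP-> rxy]] /orP[lyz|/andP[/eqP Eyz ryz]].
  + by rewrite (ltn_trans lxy).
  + by rewrite -Eyz lxy.
  + by rewrite lyz.
  + rewrite Eyz eqxx orbC /= in rxy ryz *.
    by case: (odd (h z)) rxy ryz => ? ?; rewrite (tr y).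
- rewrite /tie_less; case: ltngtP => //= ->.
  by case: (odd _); rewrite ?[_ || sless x y]orbC tot.
Qed.

(** The flip sends a value [v] to [M - 1 - v]. This reverses the order of values but, [M] being odd,
    keeps the parity and so the direction in which ties are read; the letters themselves are
    reversed. *)
Lemma tie_less_flip M (h : {ffun X -> 'I_M}) x y : odd M -> odd_fun h ->
  tie_less h (sflip x) (sflip y) = tie_less h y x.
Proof.
move=> oM /forallP odd_h; rewrite /tie_less !(eqP (odd_h _)) !sless_flip /=.
have := ltn_ord (h x); have := ltn_ord (h y).
move: (val (h x)) (val (h y)) => a b bM aM.
have -> : (M - a.+1 < M - b.+1)%N = (b < a)%N by lia.
have -> : (M - a.+1 == M - b.+1)%N = (b == a) by lia.
case: (eqVneq b a) => //= ->.
by have -> : odd (M - a.+1) = odd a by lia.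
Qed.

Definition sorts p M (h : {ffun X -> 'I_M}) := order_iso sless (tie_less h) p.

Lemma sorts_signed M (h : {ffun X -> 'I_M}) p : odd M -> odd_fun h ->
  sorts p h -> is_signed p.
Proof.
move=> oM odd_h sp.
(* The flip reverses both orders, so the conjugate of [p] by it also sorts [h]; uniqueness makes it
   equal to [p]. *)
have q_inj : injective (fun x => sflip (p (sflip x))).
  by move=> x y /(can_inj sflipK) /perm_inj /(can_inj sflipK).
have : perm q_inj = p.
  apply: (order_iso_inj sless_total (tie_less_total h) _ sp).
  apply/order_isoP => x y; rewrite !permE (tie_less_flip _ _ oM odd_h).
  by rewrite (order_isoE sless_total (tie_less_total h) sp) sless_flip.
move=> /permP E; apply/forallP => x; rewrite -(E (sflip x)) permE sflipK //.
Qed.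

Lemma sorts_inj p q M (h : {ffun X -> 'I_M}) : sorts p h -> sorts q h -> p = q.
Proof. exact: (order_iso_inj sless_total (tie_less_total h)). Qed.

Lemma sorts_exists M (h : {ffun X -> 'I_M}) : odd M -> odd_fun h ->
  exists p : SB n, sorts (val p) h.
Proof.
move=> oM odd_h.
have [p sp] := order_iso_exists sless_total (tie_less_total h).
by exists (exist _ p (sorts_signed oM odd_h sp)).
Qed.

(** For [M = 4k + 1] this is the unfolded form of the enriched order polynomial at [k]; unlike the
    latter it is multiplicative in [M] in an evident way. *)
Definition nsort M p := #|[set h : {ffun X -> 'I_M} | odd_fun h && sorts p h]|.

End SignedSorting.

(** * Boustrophedon numbering of a grid *)

Section Snake.

Variables L M : nat.
Implicit Types (a : 'I_L) (b : 'I_M).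

Lemma snake_subproof a b : (a * M + (if odd a then rev_ord b else b) < L * M)%N.
Proof.
set c := (if _ then _ else _); have := ltn_ord a; have := ltn_ord c.
by move: (val a) (val c) => u v vM uL; rewrite -[L](subnK uL) mulnDl mulSn; lia.
Qed.

(** The position of the cell in row [a] and column [b] when the rows are traversed in turn, the odd
    ones backwards. *)
Definition snake a b : 'I_(L * M) := Ordinal (snake_subproof a b).

Lemma snake_lt a b a' b' : (snake a b < snake a' b')%N =
  (a < a')%N || (a == a') && (if odd a then b' < b else b < b')%N.
Proof.
rewrite /=; case: (ltngtP a a') => [lt|gt|/val_inj E] /=.
- set c := (if _ then _ else _); set c' := (if _ then _ else _).
  have := ltn_ord c; move: (val a) (val a') lt (val c) (val c') => u u' lt v v'.
  by rewrite -[u'](subnK lt) mulnDl mulSn; lia.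
- set c := (if _ then _ else _); set c' := (if _ then _ else _).
  rewrite [a == a']negbTE ?andFb; last by rewrite -val_eqE /= neq_ltn gt orbT.
  have := ltn_ord c'; move: (val a) (val a') gt (val c) (val c') => u u' lt v v'.
  by rewrite -[u](subnK lt) mulnDl mulSn; move: (_ * M)%N (u' * M)%N; lia.
- rewrite E eqxx /= ltn_add2l; case: (odd a') => //=.
  by have := ltn_ord b; have := ltn_ord b'; lia.
Qed.

Lemma snake_inj a b a' b' : snake a b = snake a' b' -> a = a' /\ b = b'.
Proof.
move=> E; have := snake_lt a b a' b'; have := snake_lt a' b' a b.
rewrite E ltnn; case: (ltngtP a a') => //= /val_inj <-; rewrite eqxx /=.
by split=> //; apply: val_inj => /=; case: (odd a) H H0 => /=; lia.
Qed.

Lemma snake_eq a b a' b' :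
  (snake a b == snake a' b' :> nat) = (a == a' :> nat) && (b == b' :> nat).
Proof.
apply/idP/idP => [/eqP /ord_inj /snake_inj[-> ->]|]; first by rewrite !eqxx.
by move=> /andP[/eqP /ord_inj-> /eqP /ord_inj->].
Qed.

(** For odd [M], [a * M] has the parity of [a], and reversing a row preserves the parity of the
    column. *)
Lemma odd_snake a b : odd M -> odd (snake a b) = odd a (+) odd b.
Proof.
move=> oM; rewrite /= oddD oddM oM andbT; case: ifP => //= _.
by have := ltn_ord b; lia.
Qed.

(** A half-turn of the grid traverses the path backwards, since row [L - 1 - a] runs in the same
    direction as row [a]. *)
Lemma snake_rev a b : odd L -> odd M ->
  snake (rev_ord a) (rev_ord b) = rev_ord (snake a b).
Proof.
move=> oL oM; apply: val_inj => /=; rewrite rev_ordK.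
have := ltn_ord a; have := ltn_ord b; move: (val a) => u bM uL.
have -> : odd (L - u.+1) = odd u by lia.
have -> : (L * M = (L - u.+1) * M + (M + u * M))%N by rewrite -mulSn -mulnDl subnK.
by move: (_ * M)%N (u * M)%N => v w; case: (odd u) => /=; lia.
Qed.

End Snake.

(** * Multiplicativity of the number of sorted functions *)

Section Product.

Variables n L M : nat.
Hypotheses (oL : odd L) (oM : odd M).
Local Notation X := ('I_n * bool)%type.
Implicit Types (A : {ffun X -> 'I_L}) (f : {ffun X -> 'I_M}) (p q g : SB n).

Definition snake_fun (u : {ffun X -> 'I_L} * {ffun X -> 'I_M}) :
  {ffun X -> 'I_(L * M)} := [ffun x => snake (u.1 x) (u.2 x)].

Lemma snake_fun_bij : bijective snake_fun.
Proof.
apply: inj_card_bij => [[A f] [A' f'] /ffunP E|].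
  by congr (_, _); apply/ffunP => x; have := E x; rewrite !ffunE => /snake_inj[].
by rewrite card_prod !card_ffun !card_ord expnMn.
Qed.

Lemma odd_snake_fun A f : odd_fun (snake_fun (A, f)) = odd_fun A && odd_fun f.
Proof.
apply/forallP/andP => [h|[/forallP hA /forallP hf] x].
  by split; apply/forallP => x; move/eqP: (h x);
    rewrite !ffunE /= -snake_rev // => /snake_inj[EA Ef]; rewrite ?EA ?Ef.
by rewrite !ffunE /= (eqP (hA x)) (eqP (hf x)) snake_rev.
Qed.

Definition compose_fun A p : {ffun X -> 'I_L} := [ffun x => A (val p x)].

Lemma compose_fun_bij p : bijective (compose_fun^~ p).
Proof.
exists (fun A => [ffun x => A ((val p)^-1 x)%g]) => A; apply/ffunP => x.
  by rewrite !ffunE permKV.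
by rewrite !ffunE permK.
Qed.

Lemma odd_compose_fun A p : odd_fun (compose_fun A p) = odd_fun A.
Proof.
have /forallP sp := valP p.
apply/forallP/forallP => h x.
  have := h ((val p)^-1 x)%g.
  by rewrite !ffunE (eqP (sp _)) permKV.
by rewrite !ffunE (eqP (sp _)).
Qed.

(** Where [A] ties at a value [a], the snake order is [tie_less f], reversed if [a] is odd: parities
    add, so the remaining ties are reversed as well. Since [p] sorts [f], pulling back along [p]
    turns [tie_less f] into the natural order of letters. *)
Lemma tie_less_snake A f p x y : sorts (val p) f ->
  tie_less (snake_fun (A, f)) (val p x) (val p y) = tie_less (compose_fun A p) x y.
Proof.
move=> sp; have E := order_isoE (@sless_total n) (tie_less_total f) sp.
rewrite {2}/tie_less -!E /tie_less !ffunE -/(snake_fun _).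
rewrite snake_lt snake_eq odd_snake //=; rewrite -!val_eqE /=.
case: ltngtP => //= EA; rewrite EA; case: (odd _); case: ltngtP => //= Ef.
all: by rewrite ?Ef; case: (odd _).
Qed.

Lemma sorts_snake A f p q g : sorts (val p) f -> (val q * val p)%g = val g ->
  sorts (val g) (snake_fun (A, f)) = sorts (val q) (compose_fun A p).
Proof.
move=> sp E; apply/order_isoP/order_isoP => h x y lxy; have := h x y lxy;
  by rewrite -E !permM tie_less_snake.
Qed.

Lemma SB_divr p g : exists2 q, (val q * val p)%g = val g &
  forall q', (val q' * val p)%g = val g -> q' = q.
Proof.
have /forallP sp := valP p; have /forallP sg := valP g.
have sq : is_signed (val g * (val p)^-1)%g.
  apply/forallP => x; rewrite !permM (eqP (sg x)); set y := val g x.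
  by rewrite -{1}(permKV (val p) y) -(eqP (sp _)) permK.
pose q : SB n := exist _ (val g * (val p)^-1)%g sq.
exists q => [|q' E]; first by rewrite /= mulgKV.
by apply: val_inj => /=; rewrite -E mulgK.
Qed.

(** Each function with [L * M] values is the snake of a unique pair [(A, f)]. The pairs are
    classified by the unique [p] that sorts [f]; then [g] sorts the snake exactly when the [q] with
    [g = p o q] sorts [A o p]. *)
Lemma nsort_mul g : nsort (L * M) (val g) =
  (\sum_(p : SB n) \sum_(q : SB n | (val q * val p)%g == val g)
     nsort M (val p) * nsort L (val q))%N.
Proof.
rewrite /nsort -(on_card_preimset (onW_bij _ snake_fun_bij)).
pose P p := [set u | (odd_fun u.2 && sorts (val p) u.2) &&
  (odd_fun u.1 && sorts (val g) (snake_fun u))].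
transitivity (\sum_(p : SB n) #|P p|)%N.
  under eq_bigr => p _ do rewrite -sum1dep_card big_mkcond /=.
  rewrite exchange_big /= -sum1dep_card big_mkcond; apply: eq_bigr => [[A f] _] /=.
  rewrite !inE odd_snake_fun.
  case oA: (odd_fun A); last by rewrite big1 // => p _; rewrite andbF.
  case of_: (odd_fun f); last by rewrite big1.
  case sg: (sorts _ _); last by rewrite big1 // => p _; rewrite !andbF.
  have [p sp] := sorts_exists oM of_.
  rewrite (bigD1 p) //= sp /= big1 // => q nqp.
  case sq: (sorts _ f) => //.
  by rewrite (val_inj (sorts_inj sq sp)) eqxx in nqp.
apply: eq_bigr => p _; have [q Eq uq] := SB_divr p g.
rewrite (big_pred1 q) => [|q' /=]; last first.
  by apply/eqP/eqP => [/uq//|->].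
(* Reindexing the coarse functions by [A |-> A o p] makes [P p] a product of two independent
   sets. *)
rewrite -(on_card_preimset (onW_bij _ (compose_fun_bij p))) mulnC -cardsX.
apply: eq_card => [[A f]]; rewrite !inE /= odd_compose_fun.
case sp: (odd_fun f && _); last by rewrite andbF.
by case/andP: sp => _ sp; rewrite (sorts_snake _ sp Eq) andbT.
Qed.

End Product.

(** * Unfolding enriched sequences to odd functions *)

Definition enriched_less : rel (nat * int) := fun u v =>
  (u.1 < v.1)%N || (u.1 == v.1) && (if odd u.1 then v.2 < u.2 else u.2 < v.2).

Lemma enriched_less_trans : transitive enriched_less.
Proof.
move=> [b v] [a u] [c w]; rewrite /enriched_less /=.
move=> /orP[lab|/andP[/eqP-> ruv]] /orP[lbc|/andP[/eqP Ebc rvw]].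
- by rewrite (ltn_trans lab).
- by rewrite -Ebc lab.
- by rewrite lbc.
- subst c; rewrite eqxx ltnn /=.
  by case: (odd b) ruv rvw => ruv rvw; [apply: lt_trans rvw ruv|apply: lt_trans ruv rvw].
Qed.

Section Unfolding.

Variables n k : nat.
Local Notation X := ('I_n * bool)%type.
Implicit Types (p : SB n) (a : {ffun 'I_n -> 'I_(2 * k + 1)}).

Definition letter p (i : 'I_n) : int := sval_int (val p (i, false)).

Lemma letter_flip p i : sval_int (val p (i, true)) = - letter p i.
Proof.
have /forallP/(_ (i, false))/eqP := valP p.
by rewrite /letter -sval_int_flip => <-.
Qed.

Lemma letter_neq0 p i : letter p i != 0.
Proof. by rewrite /letter /sval_int; case: ((val p _).2). Qed.

Lemma letter_inj p : injective (letter p).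
Proof. by move=> i j /sval_int_inj /perm_inj []. Qed.

Definition marked_word p a : seq (nat * int) :=
  [seq (val (a i), letter p i) | i <- enum 'I_n].

(** Consecutive letters are distinct, the initial 0 included, so each step is an ascent or a
    descent, and its condition is one comparison of (value, letter) pairs. *)
Lemma omegaB_condE p a : omegaB_cond p a = path enriched_less (0%N, 0) (marked_word p a).
Proof.
have sz : size (marked_word p a) = n by rewrite size_map size_enum_ord.
pose c s : nat * int :=
  (nth 0%N (0%N :: [seq val (a i) | i <- enum 'I_n]) s, nth 0 (sb_word p) s).
have cE s : (s <= n)%N -> nth (0%N, 0) ((0%N, 0) :: marked_word p a) s = c s.
  case: s => [|s] // lt_s.
  rewrite /c /= !(nth_map (Ordinal lt_s)) -?enumT ?size_enum_ord //.
have c_neq s : (s < n)%N -> (c s).2 != (c s.+1).2.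
  move=> lt_s; rewrite /c /= (nth_map (Ordinal lt_s)) ?size_enum_ord //.
  have -> : nth (Ordinal lt_s) (enum 'I_n) s = Ordinal lt_s.
    by apply: val_inj; rewrite /= nth_enum_ord.
  case: s lt_s => [|s] lt_s /=; first by rewrite eq_sym (letter_neq0 p).
  rewrite (nth_map (Ordinal lt_s)) ?size_enum_ord ?(ltnW lt_s) //.
  apply/negP => /eqP /(@letter_inj p) /(congr1 val) /=.
  by rewrite nth_enum_ord ?(ltnW lt_s) // => /n_Sn.
apply/idP/idP => [/forallP h|/(pathP (0%N, 0)) h].
  apply/(pathP (0%N, 0)) => s.
  rewrite sz => lt_s; have := h (Ordinal lt_s).
  rewrite -[nth _ (marked_word _ _) s]/(nth (0%N, 0) ((0%N, 0) :: marked_word p a) s.+1).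
  rewrite (cE s) ?(ltnW lt_s) // (cE s.+1) //; have := c_neq _ lt_s.
  rewrite /enriched_less /c /=.
  set u := nth 0 _ _; set v := nth 0 _ _; set x := nth 0%N _ _; set y := nth 0%N _ _.
  by case: (ltgtP u v) => //=; case: (ltngtP x y) => //= ->; case: (odd y).
rewrite /omegaB_cond; apply/forallP => s.
have lt_s := ltn_ord s; have := h s; rewrite sz => /(_ lt_s).
rewrite -[nth _ (marked_word _ _) s]/(nth (0%N, 0) ((0%N, 0) :: marked_word p a) s.+1).
rewrite (cE s) ?(ltnW lt_s) // (cE s.+1) //; have := c_neq _ lt_s.
rewrite /enriched_less /c /=.
set u := nth 0 _ _; set v := nth 0 _ _; set x := nth 0%N _ _; set y := nth 0%N _ _.
by case: (ltgtP u v) => //=; case: (ltngtP x y) => //= ->; case: (odd y).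
Qed.

Lemma omegaB_condP p a : reflect
  ((forall i, enriched_less (0%N, 0) (val (a i), letter p i)) /\
   (forall i j : 'I_n, (i < j)%N ->
      enriched_less (val (a i), letter p i) (val (a j), letter p j)))
  (omegaB_cond p a).
Proof.
rewrite omegaB_condE path_sortedE; last exact: enriched_less_trans.
rewrite (sorted_pairwise enriched_less_trans) pairwise_map all_map.
apply: (iffP andP) => [[/allP h0 /pairwiseP h]|[h0 h]]; split.
- by move=> i; apply: h0; rewrite mem_enum.
- move=> i j lij; have := h i i j.
  by rewrite !inE size_enum_ord !ltn_ord /= !nth_ord_enum; apply.
- by apply/allP => i _; apply: h0.
- apply: (sub_pairwise h); rewrite -(pairwise_map val ltn) val_enum_ord.
  by rewrite -(sorted_pairwise ltn_trans) iota_ltn_sorted.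
Qed.

Lemma unfold_subproof (u : 'I_(2 * k + 1)) (s : bool) :
  ((if s then 2 * k - u else 2 * k + u) < 4 * k + 1)%N.
Proof. by have := ltn_ord u; case: s; lia. Qed.

(** The letter at position [i] of [p] gets the value [a i] and its negative gets [- a i]. The shift
    by [2 * k] keeps values nonnegative and does not change parity. *)
Definition unfold p a : {ffun X -> 'I_(4 * k + 1)} :=
  [ffun x => let y := ((val p)^-1 x)%g in Ordinal (unfold_subproof (a y.1) y.2)].

Lemma unfoldE p a y : val (unfold p a (val p y)) =
  if y.2 then (2 * k - a y.1)%N else (2 * k + a y.1)%N.
Proof. by rewrite ffunE /= permK. Qed.

Lemma odd_unfold p a : odd_fun (unfold p a).
Proof.
have /forallP sp := valP p.
apply/forallP => x; rewrite -[x](permKV (val p)); set y := ((val p)^-1 x)%g.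
rewrite -(eqP (sp y)); apply/eqP/val_inj; rewrite /= !unfoldE /=.
by have := ltn_ord (a y.1); case: y.2 => /=; lia.
Qed.

Lemma unfold_inj p : injective (unfold p).
Proof.
move=> a a' E; apply/ffunP => i; apply: val_inj.
by move/ffunP: E => /(_ (val p (i, false)))/(congr1 val); rewrite !unfoldE /=; lia.
Qed.

Lemma sorts_unfold p a : sorts (val p) (unfold p a) = omegaB_cond p a.
Proof.
have lt_a i := ltn_ord (a i).
apply/order_isoP/omegaB_condP => [h|[h0 h] [i b] [j c]].
  split=> [i|i j lij].
    (* Comparing position [-i] with [i] gives the condition at the initial 0: if [a i = 0], then the
       letter exceeds its negative, so it is positive. *)
    have := h (i, true) (i, false); rewrite /tie_less /sless !unfoldE /=.
    rewrite letter_flip -/(letter p i) /enriched_less /= => /(_ isT).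
    by case: (ltngtP 0%N (a i)) (lt_a i) => //=; case: ifP; lia.
  have := h (i, false) (j, false); rewrite /tie_less /sless !unfoldE /=.
  rewrite -/(letter p i) -/(letter p j) /enriched_less /= ltn_add2l eqn_add2l.
  by rewrite oddD oddM /=; apply; rewrite /sval_int /=; lia.
have hi := h0 i; have hj := h0 j; have hij := h i j; have hji := h j i.
move: (lt_a i) (lt_a j) hi hj hij hji.
rewrite /tie_less /sless !unfoldE /= /enriched_less /=.
case: b c => [] [];
  rewrite /= ?letter_flip -?/(letter p i) -?/(letter p j) {1}/sval_int {1}/sval_int /=.
all: move: (letter p i) (letter p j) (nat_of_ord (a i)) (nat_of_ord (a j)) => u v s t ls lt.
all: have Ea : odd (2 * k + s) = odd s by lia.
all: have Eb : odd (2 * k - s) = odd s by lia.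
all: rewrite ?Ea ?Eb; case: (ltngtP s t) => [| |<-]; clear -ls lt; rewrite ?eqxx ?ltnn /=.
all: by try case Es: (odd s) => /=; lia.
Qed.

Lemma omegaB_nsort p : omegaB p k = nsort (4 * k + 1) (val p).
Proof.
rewrite /omegaB /nsort -(card_imset _ (@unfold_inj p)); apply: eq_card => h.
rewrite inE; apply/imsetP/andP => [[a]|[odd_h sh]].
  by rewrite inE => ca ->; rewrite odd_unfold sorts_unfold.
have hE i s : val (h (val p (i, s))) =
    if s then (4 * k - h (val p (i, false)))%N else h (val p (i, false)).
  case: s => //; have /forallP/(_ (i, false))/eqP := valP p; rewrite /sflip /= => ->.
  by have /forallP/(_ (val p (i, false)))/eqP -> := odd_h; rewrite /=; lia.
(* Position [-i] comes before [i] and carries the reversed value, so [4k - v <= v]. Subtracting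
   [2 * k] therefore folds [h] back to a sequence. *)
have h_ge i : (2 * k <= h (val p (i, false)))%N.
  move/order_isoP: sh => /(_ (i, true) (i, false) isT); rewrite /tie_less (hE i true).
  by move: (nat_of_ord (h _)) => v /orP[|/andP[/eqP E _]]; lia.
have lt_a i : (h (val p (i, false)) - 2 * k < 2 * k + 1)%N.
  by have := ltn_ord (h (val p (i, false))); lia.
pose a : {ffun 'I_n -> 'I_(2 * k + 1)} := [ffun i => Ordinal (lt_a i)].
have aE i : a i = (h (val p (i, false)) - 2 * k)%N :> nat by rewrite ffunE.
have Eh : h = unfold p a.
  apply/ffunP => x; rewrite -[x](permKV (val p)); case: ((val p)^-1 x)%g => i s.
  apply: val_inj; rewrite unfoldE hE aE.
  have := h_ge i; have := ltn_ord (h (val p (i, false))).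
  by move: (h _) => [v lt_v] /=; case: s => /=; lia.
by exists a => //; rewrite inE -sorts_unfold -Eh.
Qed.

End Unfolding.

(** * Indefinite summation of polynomials *)

Definition falling_poly m : {poly rat} := \prod_(i <- iota 0 m) ('X - i%:R%:P).

Lemma horner_falling_poly m d : (falling_poly m).[d%:R] = ('C(d, m) * m`!)%:R.
Proof.
rewrite bin_ffact /falling_poly; elim: m => [|m IHm]; first by rewrite big_nil hornerC.
rewrite -addn1 iotaD big_cat big_seq1 hornerM IHm add0n addn1 ffactnSr natrM.
rewrite !hornerE; have [le_md|lt_dm] := leqP m d; first by rewrite natrB.
by rewrite ffact_small // !mul0r.
Qed.

Lemma sum_bin m d : (\sum_(e < d) 'C(e, m))%N = 'C(d, m.+1).
Proof. by elim: d => [|d IHd]; rewrite ?big_ord0 // big_ord_recr IHd binS. Qed.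

(** Induction on a degree bound: subtracting a multiple of a falling factorial removes the top term,
    and falling factorials are summed by the hockey-stick identity. *)
Lemma sum_poly (p : {poly rat}) :
  exists s : {poly rat}, forall d : nat, s.[d%:R] = \sum_(e < d) p.[e%:R].
Proof.
have [m] := ubnP (size p); elim: m p => // m IHm p.
rewrite ltnS => sz_p; case: m IHm sz_p => [|m] IHm sz_p.
  exists 0 => d; move: sz_p; rewrite leqn0 size_poly_eq0 => /eqP->.
  by rewrite horner0 big1 // => e _; rewrite horner0.
have sz_f : size (falling_poly m) = m.+1.
  by rewrite size_prod_XsubC size_iota.
have f_m : (falling_poly m)`_m = 1.
  have /eqP := monic_prod_XsubC (iota 0 m) xpredT (fun i => i%:R : rat).
  by rewrite /lead_coef -/(falling_poly m) sz_f.
have [s sE] : exists s : {poly rat}, forall d : nat,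
    s.[d%:R] = \sum_(e < d) (p - p`_m *: falling_poly m).[e%:R].
  apply: IHm; rewrite ltnS; apply/leq_sizeP => j le_mj.
  rewrite coefB coefZ; have [<-|ne_mj] := eqVneq m j; first by rewrite f_m mulr1 subrr.
  have lt_mj : (m < j)%N by rewrite ltn_neqAle ne_mj.
  have -> : p`_j = 0 by rewrite nth_default ?(leq_trans sz_p).
  have -> : (falling_poly m)`_j = 0 by rewrite nth_default ?sz_f.
  by rewrite mulr0 subr0.
(* The sum of [falling_poly m] over [e < d] is the value of [falling_poly m.+1] at [d] divided by
   [m + 1]. *)
exists (s + (p`_m / m.+1%:R) *: falling_poly m.+1) => d.
rewrite hornerD sE hornerZ horner_falling_poly -sum_bin factS.
rewrite [X in _ + X](_ : _ = \sum_(e < d) p`_m * (falling_poly m).[e%:R]).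
  by rewrite -big_split /=; apply: eq_bigr => e _; rewrite hornerD hornerN hornerZ subrK.
rewrite mulnCA natrM mulrA divfK ?pnatr_eq0 // big_distrl /= natr_sum mulr_sumr.
by apply: eq_bigr => e _; rewrite horner_falling_poly.
Qed.

(** * Polynomiality of the number of enriched sequences *)

Section PathCount.

Variable K : nat.

Definition path_count n (w : 'I_n -> int) (c : nat * int) : nat :=
  #|[set a : {ffun 'I_n -> 'I_K} |
     path enriched_less c [seq (val (a i), w i) | i <- enum 'I_n]]|.

Lemma path_count0 (w : 'I_0 -> int) c : path_count w c = 1%N.
Proof.
rewrite /path_count enum_ord0 /=.
by have := card_ffun 'I_0 'I_K; rewrite !card_ord expn0 -cardsT => <-; apply: eq_card.
Qed.

Lemma path_countS n (w : 'I_n.+1 -> int) c : path_count w c =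
  (\sum_(i < K | enriched_less c (val i, w ord0))
    path_count (w \o lift ord0) (val i, w ord0))%N.
Proof.
pose cons_fun (u : 'I_K * {ffun 'I_n -> 'I_K}) : {ffun 'I_n.+1 -> 'I_K} :=
  [ffun i => oapp u.2 u.1 (unlift ord0 i)].
have cons_bij : bijective cons_fun.
  exists (fun a : {ffun 'I_n.+1 -> 'I_K} => (a ord0, [ffun i => a (lift ord0 i)])).
    move=> [x a]; rewrite /cons_fun; congr (_, _); first by rewrite ffunE unlift_none.
    by apply/ffunP => i; rewrite !ffunE liftK.
  move=> a; apply/ffunP => i; rewrite ffunE /=.
  by case: unliftP => [j|] -> //=; rewrite ffunE.
rewrite /path_count -(on_card_preimset (onW_bij _ cons_bij)).
pose tail_path (i : 'I_K) (a : {ffun 'I_n -> 'I_K}) :=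
  path enriched_less (val i, w ord0)
    [seq (val (a j), (w \o lift ord0) j) | j <- enum 'I_n].
rewrite -sum1_card (eq_bigl (fun u : 'I_K * {ffun 'I_n -> 'I_K} =>
  enriched_less c (val u.1, w ord0) && tail_path u.1 u.2)).
  rewrite -(pair_big_dep (fun i : 'I_K => enriched_less c (val i, w ord0))
     tail_path (fun _ _ => 1%N)) /=.
  by apply: eq_bigr => i _; rewrite sum1dep_card.
case=> x a; rewrite !inE enum_ordSl /= ffunE unlift_none /=.
congr (_ && path _ _ _); rewrite -map_comp.
by apply: eq_map => i /=; rewrite ffunE liftK.
Qed.

End PathCount.

(** The next value either stays at [m], when the parity of [m] allows the step of letters, or is any
    larger value, whatever the letters. *)
Lemma sum_enriched_less K (N : nat -> nat) m l v : (m < K)%N ->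
  (\sum_(i < K | enriched_less (m, l) (val i, v)) N i =
   (if if odd m then (v < l)%R else (l < v)%R then N m else 0) +
   \sum_(m.+1 <= i < K) N i)%N.
Proof.
move=> lt_mK; rewrite -(big_mkord (fun i => enriched_less (m, l) (i, v)) N).
rewrite (big_cat_nat (n := m)) ?(ltnW lt_mK) //= big_nat_cond big1 ?add0n; last first.
  by move=> i; rewrite /enriched_less /=; lia.
rewrite big_ltn_cond // /enriched_less /= ltnn eqxx /= big_nat_cond [in RHS]big_nat_cond.
rewrite [X in if _ then _ + X else X](_ : _ =
  \sum_(m.+1 <= i < K | (m < i < K)%N && true) N i)%N.
  by case: ifP => // _; rewrite add0n.
by apply: eq_bigl => i; lia.
Qed.

(** The values above [2j] split into pairs [2i - 1], [2i] with [j < i <= k]; both members of a pair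
    have [d = k - i] levels above them. *)
Lemma sum_above (N : nat -> nat) (Q0 Q1 : nat -> rat) k :
  (forall j, (j <= k)%N -> (N (2 * j)%N)%:R = Q0 (k - j)%N) ->
  (forall j, (0 < j <= k)%N -> (N (2 * j).-1)%:R = Q1 (k - j)%N) ->
  forall j, (j <= k)%N ->
  (\sum_((2 * j).+1 <= i < 2 * k + 1) N i)%N%:R = \sum_(d < k - j) (Q0 d + Q1 d) :> rat.
Proof.
move=> N0 N1 j le_jk; rewrite -(subKn le_jk); move: (k - j)%N (leq_subr j k) => d.
elim: d => [|d IHd] le_dk.
  by rewrite subn0 subnn addn1 big_geq // big_ord0.
rewrite subKn // big_ord_recr /= -[in RHS](subKn (ltnW le_dk)) -IHd ?(ltnW le_dk) //.
rewrite big_ltn; last lia.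
rewrite big_ltn; last lia.
have -> : (2 * (k - d.+1)).+3 = (2 * (k - d)).+1 by lia.
have := N0 (k - d)%N (leq_subr _ _); have := N1 (k - d)%N.
rewrite subKn ?(ltnW le_dk) // => <-; last lia.
move=> <-; rewrite addnA natrD addrC natrD; congr (_ + _); rewrite addrC.
by congr (_%:R + _%:R); congr N; lia.
Qed.

(* The count depends on the previous value only through its type and the number
   [k - j] of levels above it. *)
Lemma path_count_poly n (w : 'I_n -> int) (l : int) :
  exists Q : {poly rat} * {poly rat}, forall k j, (j <= k)%N ->
    (path_count (2 * k + 1) w ((2 * j)%N, l))%:R = Q.1.[(k - j)%:R] /\
    ((0 < j)%N -> (path_count (2 * k + 1) w ((2 * j).-1, l))%:R = Q.2.[(k - j)%:R]).
Proof.
elim: n w l => [|n IHn] w l.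
  by exists (1, 1) => k j _; rewrite !path_count0 !hornerC.
have [[Q0 Q1] /= QE] := IHn (w \o lift ord0) (w ord0).
have [S SE] := sum_poly (Q0 + Q1).
(* [S] counts the moves beyond [2j], and the indicator terms those that stay, at an ascent or at a
   descent. From [2j - 1] one may also move to [2j], whence the extra [Q0]. *)
exists (S + (l < w ord0)%R%:R *: Q0, S + Q0 + (w ord0 < l)%R%:R *: Q1) => k j le_jk /=.
pose N m := path_count (2 * k + 1) (w \o lift ord0) (m, w ord0).
have N0 i : (i <= k)%N -> (N (2 * i)%N)%:R = Q0.[(k - i)%:R] by move=> /QE[].
have N1 i : (0 < i <= k)%N -> (N (2 * i).-1)%:R = Q1.[(k - i)%:R].
  by move=> /andP[i_gt0 /QE[_ ->]].
have above := @sum_above N (fun d => Q0.[d%:R]) (fun d => Q1.[d%:R]) k N0 N1 j le_jk.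
have {}above : (\sum_((2 * j).+1 <= i < 2 * k + 1) N i)%N%:R = S.[(k - j)%:R] :> rat.
  by rewrite above SE; apply: eq_bigr => d _; rewrite hornerD.
rewrite !path_countS; split=> [|j_gt0].
  rewrite (sum_enriched_less N); last lia.
  rewrite oddM /= natrD above hornerD hornerZ -N0 // addrC; congr (_ + _).
  by case: ifP; rewrite ?mul1r ?mul0r.
rewrite (sum_enriched_less N); last lia.
have -> : odd (2 * j).-1 by lia.
rewrite big_ltn; last lia.
have -> : (2 * j).-1.+1 = (2 * j)%N by lia.
rewrite !natrD above !hornerD hornerZ -N0 // -N1 ?j_gt0 // addrC [S.[_] + _]addrC.
by congr (_ + _); case: ifP; rewrite ?mul1r ?mul0r.
Qed.

Lemma omegaB_poly n (p : SB n) :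
  exists P : {poly rat}, forall k : nat, P.[k%:R] = (omegaB p k)%:R.
Proof.
have [[Q0 Q1] QE] := path_count_poly (letter p) 0.
exists Q0 => k; have [/=] := QE k 0%N (leq0n k); rewrite subn0 muln0 => <- _.
by congr _%:R; apply: eq_card => a; rewrite !inE omegaB_condE.
Qed.

(** * The product formula at integers and its extension to polynomials *)

Lemma omegaB_mul n (g : SB n) k l : omegaB g (4 * (k * l) + k + l) =
  (\sum_(p : SB n) \sum_(q : SB n | (val q * val p)%g == val g)
     omegaB p k * omegaB q l)%N.
Proof.
rewrite omegaB_nsort.
have -> : (4 * (4 * (k * l) + k + l) + 1 = (4 * l + 1) * (4 * k + 1))%N by lia.
(* The fine function has [4k + 1] values and is sorted by [p]; the coarse one has [4l + 1] and gives
   [q]. *)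
rewrite nsort_mul; try lia.
by apply: eq_bigr => p _; apply: eq_bigr => q _; rewrite !omegaB_nsort.
Qed.

Lemma poly_eq0_inj (R : idomainType) (p : {poly R}) (u : nat -> R) :
  injective u -> (forall k, p.[u k] = 0) -> p = 0.
Proof.
move=> u_inj pu0; apply/eqP/negPn/negP => p_neq0.
have rt : all (root p) [seq u i | i <- iota 0 (size p)].
  by apply/allP => _ /mapP[i _ ->]; apply/rootP.
have := max_poly_roots p_neq0 rt; rewrite map_inj_uniq // iota_uniq.
by rewrite size_map size_iota ltnn => /(_ isT).
Qed.

Definition evalXY (x y : rat) (F : polyXY) : rat := (F.[y%:P]).[x].

(** The difference, as a polynomial in [y] over the domain Q[x], vanishes at infinitely many
    constants, because each of its values there is a polynomial in [x] with infinitely many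
    roots. *)
Lemma evalXY_eq (F G : polyXY) :
  (forall k l : nat, evalXY (4 * k + 1)%:R (4 * l + 1)%:R F =
                     evalXY (4 * k + 1)%:R (4 * l + 1)%:R G) -> F = G.
Proof.
move=> E; have u_inj : injective (fun k : nat => (4 * k + 1)%:R : rat).
  by move=> i j /eqP; rewrite eqr_nat => /eqP; lia.
apply/eqP; rewrite -subr_eq0; apply/eqP.
apply: (@poly_eq0_inj _ _ (fun l : nat => ((4 * l + 1)%:R : rat)%:P)).
  by move=> i j /polyC_inj /u_inj.
move=> l; apply: (poly_eq0_inj u_inj) => k.
by apply/eqP; rewrite !hornerD !hornerN subr_eq0 -![_.[_].[_]]/(evalXY _ _ _) E.
Qed.

Lemma evalXYD x y F G : evalXY x y (F + G) = evalXY x y F + evalXY x y G.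
Proof. by rewrite /evalXY !hornerD. Qed.

Lemma evalXYM x y F G : evalXY x y (F * G) = evalXY x y F * evalXY x y G.
Proof. by rewrite /evalXY !hornerM. Qed.

Lemma evalXY_rhoB n (P : SB n -> {poly rat}) (z : polyXY) p x y :
  evalXY x y (rhoB P z p) = (P p).[(evalXY x y z - 1) / 4%:R].
Proof.
rewrite ffunE; set t := (z - 1) * _.
have -> : (evalXY x y z - 1) / 4%:R = evalXY x y t.
  by rewrite evalXYM /evalXY !hornerE.
elim/poly_ind: (P p) => [|q c IHq]; first by rewrite map_poly0 /evalXY !horner0.
have mapE : map_poly (fun c : rat => (c%:P)%:P : polyXY) (q * 'X + c%:P) =
    map_poly (fun c : rat => (c%:P)%:P : polyXY) q * 'X + (c%:P)%:P%:P.
  (* Written as a composite of two constant embeddings, the coefficient map is a ring morphism. *)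
  rewrite -[map_poly _]/(map_poly (polyC \o polyC)).
  by rewrite rmorphD rmorphM /= map_polyX map_polyC.
by rewrite mapE !hornerMXaddC evalXYD evalXYM IHq [evalXY _ _ _%:P]/evalXY !hornerC.
Qed.

Unset Implicit Arguments.

Theorem theorem3p8 (n : nat) (hn : (1 <= n)%N) :
  exists P : SB n -> {poly rat},
    (forall (p : SB n) (k : nat), (P p).[k%:R] = (omegaB p k)%:R) /\
    ga_mul (rhoB P varX) (rhoB P varY) = rhoB P (varX * varY).
Proof.
have [P PE] := fin_all_exists (@omegaB_poly n).
exists P; split=> //; apply/ffunP => g; apply: evalXY_eq => k l.
have half m : ((4 * m + 1)%:R - 1) / 4%:R = m%:R :> rat.
  by rewrite natrD addrK natrM mulrC mulKf // pnatr_eq0.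
have evX : evalXY (4 * k + 1)%:R (4 * l + 1)%:R varX = (4 * k + 1)%:R.
  by rewrite /evalXY /varX !hornerE.
have evY : evalXY (4 * k + 1)%:R (4 * l + 1)%:R varY = (4 * l + 1)%:R.
  by rewrite /evalXY /varY !hornerE.
rewrite evalXY_rhoB evalXYM evX evY -natrM.
(* The product is again 1 modulo 4, so [(xy - 1) / 4] is the natural number [4kl + k + l], where the
   polynomial counts sequences. *)
have -> : ((4 * k + 1) * (4 * l + 1) = 4 * (4 * (k * l) + k + l) + 1)%N by lia.
rewrite half PE omegaB_mul ffunE /evalXY !horner_sum natr_sum.
apply: eq_bigr => p _; rewrite !horner_sum natr_sum; apply: eq_bigr => q _.
rewrite -[LHS]/(evalXY _ _ (_ * _)) evalXYM !evalXY_rhoB evX evY !half !PE.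
by rewrite natrM.
Qed.
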